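(* Let $k\ge2$, let $\Gamma_k=\langle a_1,\ldots,a_k,b_1,\ldots,b_k\mid a_1b_1a_1^{-1}b_1^{-1}\cdots a_kb_ka_k^{-1}b_k^{-1}\rangle$ be the fundamental group of a closed oriented surface of genus $k$, $\mathbb{C}\Gamma_k$ its group $*$-algebra, and $\varepsilon\colon\mathbb{C}\Gamma_k\to\mathbb{C}$ the linear extension of the trivial representation. Let $D$ be a pre-Hilbert space. \begin{enumerate} \item[(a)] For any $x_1,\ldots,x_k,y_1,\ldots,y_k\in D$ there exists a unique Gaussian cocycle $\eta\colon\mathbb{C}\Gamma_k\to D$ on $(\mathbb{C}\Gamma_k,\varepsilon)$ with $\eta(a_j)=x_j$ and $\eta(b_j)=y_j$ for $j=1,\ldots,k$. \item[(b)] A Gaussian cocycle $\eta$ on $(\mathbb{C}\Gamma_k,\varepsilon)$ admits a generating functional if and only if \[ \sum_{j=1}^k\langle\eta(a_j),\eta(b_j)\rangle\in\mathbb{R}. \] In particular, $(\mathbb{C}\Gamma_k,\varepsilon)$ does not have property (GC). \end{enumerate}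
   Context: The involution on the group $*$-algebra is $g^*=g^{-1}$, and $\varepsilon(g)=1$ for all group elements $g$. Put $A=\mathbb{C}\Gamma_k$. A pre-Hilbert space is a complex vector space with a positive definite inner product, linear in the second argument. A Gaussian cocycle on $(A,\varepsilon)$ is a linear map $\eta\colon A\to D$ into a pre-Hilbert space with $\eta(ab)=\varepsilon(a)\eta(b)+\eta(a)\varepsilon(b)$ for all $a,b\in A$ (it is a cocycle for the representation $\pi=\varepsilon\operatorname{id}_D$). It admits a generating functional if there is a linear functional $\psi\colon A\to\mathbb{C}$ with $\psi(a^* )=\overline{\psi(a)}$ and $\varepsilon(a)\psi(b)-\psi(ab)+\psi(a)\varepsilon(b)=-\langle\eta(a^* ),\eta(b)\rangle$ for all $a,b\in A$, i.e. such that $(\varepsilon\operatorname{id}_D,\eta,\psi)$ is a Schürmann triple. Property (GC): every Gaussian cocycle on $(A,\varepsilon)$, with values in any pre-Hilbert space, admits a generating functional. *)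

(* Defs.v *)
From HB Require Import structures.
From mathcomp Require Import all_boot all_order all_algebra sesquilinear finmap.
From mathcomp.multinomials Require Import monalg.
From mathcomp Require Import boolp reals complex.

Set Implicit Arguments.
Unset Strict Implicit.
Unset Printing Implicit Defensive.

Import Order.TTheory GRing.Theory Num.Theory.

Local Open Scope ring_scope.

(* The letter (s, false) stands for the generator s and (s, true) for its
   formal inverse. *)
Definition word (S : Type) := seq (S * bool).

Section PresentedGroup.
Variables (S : choiceType) (rels : seq (word S)).

Definition inv_word (w : word S) : word S :=
  rev [seq (l.1, ~~ l.2) | l <- w].

(* The congruence on words whose classes are the elements of < S | rels >:
   the least equivalence relation that allows cancelling s s^-1 and s^-1 s,
   and deleting a relator, at any position of a word. *)
Inductive word_equiv : word S -> word S -> Prop :=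
| word_equiv_refl u : word_equiv u u
| word_equiv_sym u v : word_equiv u v -> word_equiv v u
| word_equiv_trans v u w : word_equiv u v -> word_equiv v w -> word_equiv u w
| word_equiv_cancel s b u v :
    word_equiv (u ++ [:: (s, b); (s, ~~ b)] ++ v) (u ++ v)
| word_equiv_relator r u v :
    r \in rels -> word_equiv (u ++ r ++ v) (u ++ v).

Definition word_eqb (u v : word S) : bool := `[< word_equiv u v >].

Lemma word_eqb_refl : reflexive word_eqb.
Proof. by move=> u; apply/asboolP; exact: word_equiv_refl. Qed.

Lemma word_eqb_sym : symmetric word_eqb.
Proof. by move=> u v; apply/asboolP/asboolP; exact: word_equiv_sym. Qed.

Lemma word_eqb_trans : transitive word_eqb.
Proof.
by move=> v u w /asboolP uv /asboolP vw; apply/asboolP; exact: word_equiv_trans vw.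
Qed.

Canonical word_eqb_equiv :=
  EquivRel word_eqb word_eqb_refl word_eqb_sym word_eqb_trans.

Definition presented_group : Type := {eq_quot word_eqb}%qT.

HB.instance Definition _ := Choice.on presented_group.
HB.instance Definition _ := Quotient.on presented_group.

Definition word_class (w : word S) : presented_group := \pi_presented_group%qT w.

Lemma word_classP u v : reflect (word_class u = word_class v) (word_eqb u v).
Proof. exact: (@eqmodP _ word_eqb_equiv). Qed.

Lemma word_class_repr (x : presented_group) : word_class (repr x) = x.
Proof. exact: reprK. Qed.

Lemma word_class_sound u v : word_equiv u v -> word_class u = word_class v.
Proof. by move=> uv; apply/word_classP/asboolP. Qed.

Lemma word_class_exact u v : word_class u = word_class v -> word_equiv u v.
Proof. by move/word_classP/asboolP. Qed.

Lemma word_equiv_cat u u' v v' :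
  word_equiv u u' -> word_equiv v v' -> word_equiv (u ++ v) (u' ++ v').
Proof.
move=> uu' vv'; apply: (@word_equiv_trans (u' ++ v)).
  elim: uu' => {u u'} [u|u u' _|u' u u'' _ IH1 _ IH2|s b u u'|r u u' rr].
  - exact: word_equiv_refl.
  - exact: word_equiv_sym.
  - exact: word_equiv_trans IH2.
  - by rewrite -!catA; exact: word_equiv_cancel.
  - by rewrite -!catA; exact: word_equiv_relator.
elim: vv' => {v v'} [v|v v' _|v' v v'' _ IH1 _ IH2|s b v v'|r v v' rr].
- exact: word_equiv_refl.
- exact: word_equiv_sym.
- exact: word_equiv_trans IH2.
- by rewrite !(catA u'); exact: word_equiv_cancel.
- by rewrite !(catA u'); exact: word_equiv_relator.
Qed.

Lemma word_equiv_mulV w : word_equiv (w ++ inv_word w) [::].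
Proof.
elim: w => [|[s b] w IHw]; first exact: word_equiv_refl.
apply: word_equiv_trans (word_equiv_cancel s b [::] [::]).
have -> : ((s, b) :: w) ++ inv_word ((s, b) :: w)
          = [:: (s, b)] ++ (w ++ inv_word w) ++ [:: (s, ~~ b)].
  by rewrite /inv_word /= rev_cons -cats1 -catA.
apply: (word_equiv_cat (u' := [:: (s, b)])); first exact: word_equiv_refl.
exact: (word_equiv_cat IHw (word_equiv_refl _)).
Qed.

Lemma inv_wordK : involutive inv_word.
Proof.
move=> w; rewrite /inv_word map_rev revK -map_comp -[RHS]map_id.
by apply: eq_map => -[s b] /=; rewrite negbK.
Qed.

Lemma word_equiv_Vmul w : word_equiv (inv_word w ++ w) [::].
Proof. by rewrite -{2}[w]inv_wordK; exact: word_equiv_mulV. Qed.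

Definition pg_one : presented_group := word_class [::].
Definition pg_mul (x y : presented_group) : presented_group :=
  word_class (repr x ++ repr y).
Definition pg_inv (x : presented_group) : presented_group :=
  word_class (inv_word (repr x)).

Lemma pg_mulE u v : pg_mul (word_class u) (word_class v) = word_class (u ++ v).
Proof.
by apply: word_class_sound; apply: word_equiv_cat; apply: word_class_exact;
  exact: word_class_repr.
Qed.

Lemma pg_mulA : associative pg_mul.
Proof.
move=> x y z; rewrite -[x]word_class_repr -[y]word_class_repr.
by rewrite -[z]word_class_repr !pg_mulE catA.
Qed.

Lemma pg_1mul : left_id pg_one pg_mul.
Proof. by move=> x; rewrite -[x]word_class_repr pg_mulE. Qed.

Lemma pg_mul1 : right_id pg_one pg_mul.
Proof. by move=> x; rewrite -[x]word_class_repr pg_mulE cats0. Qed.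

Lemma pg_Vmul : left_inverse pg_one pg_inv pg_mul.
Proof.
move=> x; rewrite -{2}[x]word_class_repr pg_mulE.
exact/word_class_sound/word_equiv_Vmul.
Qed.

Lemma pg_mulV : right_inverse pg_one pg_inv pg_mul.
Proof.
move=> x; rewrite -{1}[x]word_class_repr pg_mulE.
exact/word_class_sound/word_equiv_mulV.
Qed.

HB.instance Definition _ := isGroup.Build presented_group
  pg_mulA pg_1mul pg_mul1 pg_Vmul pg_mulV.

Definition pg_gen (s : S) : presented_group := word_class [:: (s, false)].

End PresentedGroup.

(* inl j and inr j are the generators a_(j+1) and b_(j+1). *)
Definition surface_relator (k : nat) : word ('I_k + 'I_k)%type :=
  flatten [seq [:: (inl j, false); (inr j, false); (inl j, true); (inr j, true)]
          | j <- enum 'I_k].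

Definition surface_group (k : nat) : groupType :=
  presented_group [:: surface_relator k].

Definition surface_a (k : nat) (j : 'I_k) : surface_group k :=
  pg_gen [:: surface_relator k] (inl j).
Definition surface_b (k : nat) (j : 'I_k) : surface_group k :=
  pg_gen [:: surface_relator k] (inr j).

(* The library's ring structure on {malg R[K]} needs a monoid K with trivial
   units, hence a separate carrier with the convolution product. *)
Definition group_algebra (R : nzRingType) (G : groupType) : Type := {malg R[G]}.

Section GroupAlgebra.
Variables (R : nzRingType) (G : groupType).
Local Notation A := (group_algebra R G).

HB.instance Definition _ := GRing.Lmodule.on A.

Definition ga_elt (g : G) : A := << g >>.

Definition ga_mul (a b : A) : A :=
  \sum_(g <- msupp a) \sum_(h <- msupp b) << a@_g * b@_h *g (g * h)%g >>.

Lemma ga_mulw (d1 d2 : {fset G}) (a b : A) :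
  (msupp a `<=` d1)%fset -> (msupp b `<=` d2)%fset ->
  ga_mul a b = \sum_(g <- d1) \sum_(h <- d2) << a@_g * b@_h *g (g * h)%g >>.
Proof.
move=> le_d1 le_d2; rewrite /ga_mul (big_fset_incl _ le_d1) /=.
  apply/eq_bigr=> g _; apply/big_fset_incl => // h _ /mcoeff_outdom ->.
  by rewrite mulr0 monalgU0.
move=> g _ /mcoeff_outdom ag.
by rewrite big1 // => h _; rewrite ag mul0r monalgU0.
Qed.

Lemma ga_mulDl : left_distributive ga_mul +%R.
Proof.
move=> a b c.
rewrite (ga_mulw (msuppD_le a b) (fsubset_refl _)).
rewrite (ga_mulw (fsubsetUl _ (msupp b)) (fsubset_refl (msupp c))).
rewrite (ga_mulw (fsubsetUr (msupp a) _) (fsubset_refl (msupp c))).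
rewrite -big_split /=; apply/eq_bigr=> g _.
rewrite -big_split /=; apply/eq_bigr=> h _.
by rewrite mcoeffD mulrDl monalgUD.
Qed.

Lemma ga_mulDr : right_distributive ga_mul +%R.
Proof.
move=> c a b.
rewrite (ga_mulw (fsubset_refl _) (msuppD_le a b)).
rewrite (ga_mulw (fsubset_refl (msupp c)) (fsubsetUl _ (msupp b))).
rewrite (ga_mulw (fsubset_refl (msupp c)) (fsubsetUr (msupp a) _)).
rewrite -big_split /=; apply/eq_bigr=> g _.
rewrite -big_split /=; apply/eq_bigr=> h _.
by rewrite mcoeffD mulrDr monalgUD.
Qed.

Lemma ga_mul0l : left_zero 0 ga_mul.
Proof. by move=> a; rewrite /ga_mul msupp0 big_seq_fset0. Qed.

Lemma ga_mul0r : right_zero 0 ga_mul.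
Proof. by move=> a; rewrite /ga_mul big1 // => g _; rewrite msupp0 big_seq_fset0. Qed.

Lemma ga_mulUU (x y : R) (g h : G) :
  ga_mul << x *g g >> << y *g h >> = << x * y *g (g * h)%g >>.
Proof. by rewrite (ga_mulw msuppU_le msuppU_le) !big_seq_fset1 !mcoeffUU. Qed.

Lemma ga_ind (P : A -> Prop) :
  P 0 -> (forall a b, P a -> P b -> P (a + b)) ->
  (forall (x : R) (g : G), P << x *g g >>) -> forall a, P a.
Proof.
move=> P0 PD PU a; rewrite [a]monalgE.
by apply: (big_ind P) => // g _; exact: PU.
Qed.

Lemma ga_mulA : associative ga_mul.
Proof.
move=> a b c; elim/ga_ind: a => [|a a' IH IH'|x g].
- by rewrite !ga_mul0l.
- by rewrite !ga_mulDl IH IH'.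
elim/ga_ind: b => [|b b' IH IH'|y h].
- by rewrite ga_mul0r !ga_mul0l ga_mul0r.
- by rewrite ga_mulDl !ga_mulDr ga_mulDl IH IH'.
elim/ga_ind: c => [|c c' IH IH'|z l].
- by rewrite !ga_mul0r.
- by rewrite !ga_mulDr IH IH'.
by rewrite !ga_mulUU mulrA mulgA.
Qed.

Lemma ga_mul1l : left_id (ga_elt 1%g) ga_mul.
Proof.
elim/ga_ind => [|a b IH IH'|x g]; first exact: ga_mul0r.
- by rewrite ga_mulDr IH IH'.
by rewrite ga_mulUU mul1r mul1g.
Qed.

Lemma ga_mul1r : right_id (ga_elt 1%g) ga_mul.
Proof.
elim/ga_ind => [|a b IH IH'|x g]; first exact: ga_mul0l.
- by rewrite ga_mulDl IH IH'.
by rewrite ga_mulUU mulr1 mulg1.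
Qed.

Lemma ga_1_neq0 : ga_elt 1%g != 0.
Proof. by rewrite monalgU_eq0 oner_eq0. Qed.

HB.instance Definition _ := GRing.Zmodule_isNzRing.Build A
  ga_mulA ga_mul1l ga_mul1r ga_mulDl ga_mulDr ga_1_neq0.

Lemma ga_eltM g h : ga_elt (g * h)%g = ga_elt g * ga_elt h.
Proof. by rewrite [RHS]ga_mulUU mulr1. Qed.

Lemma ga_scaleU (x y : R) (g : G) : x *: (<< y *g g >> : A) = << x * y *g g >>.
Proof. by apply/malgP => h; rewrite mcoeffZ !mcoeffU mulrnAr. Qed.

Lemma ga_scaleAl (x : R) (a b : A) : x *: (a * b) = (x *: a) * b.
Proof.
elim/ga_ind: a => [|a a' IH IH'|y g].
- by rewrite mul0r !scaler0 mul0r.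
- by rewrite mulrDl !scalerDr mulrDl IH IH'.
elim/ga_ind: b => [|b b' IH IH'|z h].
- by rewrite !mulr0 scaler0.
- by rewrite !mulrDr scalerDr IH IH'.
by rewrite ga_scaleU [_ * _]ga_mulUU ga_scaleU mulrA -ga_mulUU.
Qed.

HB.instance Definition _ := GRing.Lmodule_isLalgebra.Build R A ga_scaleAl.

Definition ga_counit (a : A) : R := \sum_(g <- msupp a) a@_g.

Lemma ga_counit_elt (g : G) : ga_counit (ga_elt g) = 1.
Proof. by rewrite /ga_counit msuppU oner_eq0 big_seq_fset1 mcoeffUU. Qed.

End GroupAlgebra.

Arguments ga_elt {R G} g.

Section StarAlgebra.
Variables (C : numClosedFieldType) (G : groupType).
Local Notation A := (group_algebra C G).

Lemma ga_scaleAr (x : C) (a b : A) : x *: (a * b) = a * (x *: b).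
Proof.
elim/ga_ind: a => [|a a' IH IH'|y g].
- by rewrite !mul0r scaler0.
- by rewrite !mulrDl scalerDr IH IH'.
elim/ga_ind: b => [|b b' IH IH'|z h].
- by rewrite mulr0 !scaler0 mulr0.
- by rewrite mulrDr !scalerDr mulrDr IH IH'.
by rewrite ga_scaleU [_ * _]ga_mulUU ga_scaleU mulrCA -ga_mulUU.
Qed.

HB.instance Definition _ := GRing.Lalgebra_isAlgebra.Build C A ga_scaleAr.

Definition ga_star (a : A) : A :=
  \sum_(g <- msupp a) << (a@_g)^* *g (g^-1)%g >>.

Lemma ga_star_elt (g : G) : ga_star (ga_elt g) = ga_elt g^-1%g.
Proof.
by rewrite /ga_star msuppU oner_eq0 big_seq_fset1 mcoeffUU conjC1.
Qed.

End StarAlgebra.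

(* A pre-Hilbert space is an lmodType over the complex numbers with a form of
   type {dot D for Num.conj}.  Those forms are linear in their first argument;
   <x, y> is to be linear in y, hence the swap. *)
Definition inner (C : numClosedFieldType) (D : lmodType C)
  (f : {dot D for Num.conj}) (x y : D) : C := f y x.

Section GaussianCocycles.
Variables (C : numClosedFieldType) (G : groupType).
Local Notation A := (group_algebra C G).
Local Notation eps := (@ga_counit C G).

Definition gaussian_cocycle (D : lmodType C) (eta : A -> D) : Prop :=
  linear eta /\
  forall a b : A, eta (a * b) = eps a *: eta b + eps b *: eta a.

Definition admits_generating_functional (D : lmodType C)
    (f : {dot D for Num.conj}) (eta : A -> D) : Prop :=
  exists psi : A -> C,
    [/\ scalar psi,
        forall a : A, psi (ga_star a) = (psi a)^*
      & forall a b : A,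
          eps a * psi b - psi (a * b) + psi a * eps b
          = - inner f (eta (ga_star a)) (eta b)].

Definition property_GC : Prop :=
  forall (D : lmodType C) (f : {dot D for Num.conj}) (eta : A -> D),
    gaussian_cocycle eta -> admits_generating_functional f eta.

End GaussianCocycles.

(* Main.v *)
Require Import Defs.
From mathcomp Require Import all_boot all_order all_algebra sesquilinear finmap.
From mathcomp Require Import spectral ring.
From mathcomp.multinomials Require Import monalg.
From mathcomp Require Import boolp reals complex.

(** On group elements a Gaussian cocycle [eta] is just a homomorphism from the
    group to the additive group of [D], so it is free on the generators: the
    relator of the surface group is a product of commutators, and commutators
    die in an abelian group.  This is part (a).

    A generating functional of [eta] is likewise a function [phi] on the group
    with [phi g^-1] the conjugate of [phi g] and
      [phi (g h) = phi g + phi h - <eta g, eta h>],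
    which is to say that [g |-> (eta g, phi g)] is a homomorphism to the
    Heisenberg group on [D * C] with product
      [(x, s) (y, t) = (x + y, s + t - <x, y>)]
    ([admits_generating_functional_morphism]).  The functions [word_potential]
    are such homomorphisms on words, and the Heisenberg commutator of lifts of
    [x] and [y] is the central element [<y, x> - <x, y>].  Hence the value on
    the surface relator does not depend on the lift: it is [conj s - s] with
    [s = \sum_j <eta a_j, eta b_j>] ([potential_relator]).  A generating
    functional forces this value to be [phi 1 = 0], so [s] is real.
    Conversely, [hermitian_potential] is an explicit lift with the right
    behaviour under inversion, and when [s] is real it is invariant under
    deletion of the relator, hence descends to the group.

    With [D] one-dimensional, the cocycle sending [a_1] to [1], every other
    [a_j] to [0] and every [b_j] to ['i] has [s = 'i], so (GC) fails. *)

Set Implicit Arguments.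
Unset Strict Implicit.
Unset Printing Implicit Defensive.

Import GRing.Theory Num.Theory.

Local Open Scope ring_scope.

(** * Functions on a presented group *)

Section PresentedGroupFunctions.
Variables (S : choiceType) (rels : seq (word S)).
Local Notation wcl := (word_class rels).

(** The universal property of a presented group, for functions into a mere
    type: it serves for the cocycle as well as for the potential, which is not
    a homomorphism by itself. *)
Lemma word_invariant_eq (T : Type) (F : word S -> T) :
  (forall s b u v, F (u ++ [:: (s, b); (s, ~~ b)] ++ v) = F (u ++ v)) ->
  (forall r u v, r \in rels -> F (u ++ r ++ v) = F (u ++ v)) ->
  forall u v, wcl u = wcl v -> F u = F v.
Proof.
move=> Fcancel Frel u v /word_class_exact.
elim=> {u v} [//|u v _ ->//|u v w _ -> _ ->//|s b u v|r u v rr].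
- exact: Fcancel.
- exact: Frel.
Qed.

Lemma word_class_cat u v : wcl (u ++ v) = (wcl u * wcl v)%g.
Proof. by rewrite -(pg_mulE rels u v). Qed.

Lemma word_class_inv w : wcl (inv_word w) = (wcl w)^-1%g.
Proof.
apply/(mulgI (wcl w)); rewrite mulgV -word_class_cat.
exact/word_class_sound/word_equiv_mulV.
Qed.

Lemma word_class_letterV s : wcl [:: (s, true)] = (pg_gen rels s)^-1%g.
Proof. by rewrite -word_class_inv. Qed.

End PresentedGroupFunctions.

(** * Functions on words built from vectors *)

Definition word_sum (S : choiceType) (V : zmodType) (z : S -> V) (w : word S) : V :=
  \sum_(l <- w) (if l.2 then - z l.1 else z l.1).

Section WordSum.
Variables (S : choiceType) (V : zmodType) (z : S -> V).

Lemma word_sum_cat u v : word_sum z (u ++ v) = word_sum z u + word_sum z v.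
Proof. exact: big_cat. Qed.

Lemma word_sum_nil : word_sum z [::] = 0.
Proof. exact: big_nil. Qed.

Lemma word_sum1 s b : word_sum z [:: (s, b)] = if b then - z s else z s.
Proof. exact: big_seq1. Qed.

Lemma word_sum_inv w : word_sum z (inv_word w) = - word_sum z w.
Proof.
elim: w => [|[s b] w IHw]; first by rewrite word_sum_nil oppr0.
rewrite /inv_word /= rev_cons -cats1 word_sum_cat [X in X + _]IHw.
by rewrite -(cat1s _ w) word_sum_cat !word_sum1 opprD addrC; case: b; rewrite /= ?opprK.
Qed.

Lemma word_sum_cancel s b : word_sum z [:: (s, b); (s, ~~ b)] = 0.
Proof. by rewrite -cat1s word_sum_cat !word_sum1; case: b; rewrite /= ?addNr ?subrr. Qed.

End WordSum.

(** Homomorphisms to an abelian group are determined by their values on the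
    generators, through the signed sum over the letters. *)
Lemma word_sum_morphism (S : choiceType) (rels : seq (word S)) (V : zmodType)
    (phi : presented_group rels -> V) :
  (forall g h, phi (g * h)%g = phi g + phi h) ->
  forall w, phi (word_class rels w) = word_sum (phi \o pg_gen rels) w.
Proof.
move=> phiM.
have phi1 : phi 1%g = 0 by apply: (addrI (phi 1%g)); rewrite -phiM mulg1 addr0.
elim=> [|[s b] w IHw]; first by rewrite word_sum_nil.
rewrite -cat1s word_class_cat phiM word_sum_cat IHw; congr (_ + _).
rewrite word_sum1; case: b => //=.
by apply: (addrI (phi (pg_gen rels s))); rewrite word_class_letterV -phiM mulgV subrr.
Qed.

Section Inner.
Variables (C : numClosedFieldType) (D : lmodType C) (f : {dot D for Num.conj}).
Local Notation "<< x , y >>" := (inner f x y).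

Lemma innerDl x y z : << x + y, z >> = << x, z >> + << y, z >>.
Proof. exact: linearDr. Qed.
Lemma innerDr x y z : << x, y + z >> = << x, y >> + << x, z >>.
Proof. exact: linearDl. Qed.
Lemma innerNl x y : << - x, y >> = - << x, y >>.
Proof. exact: linearNr. Qed.
Lemma innerNr x y : << x, - y >> = - << x, y >>.
Proof. exact: linearNl. Qed.
Lemma inner0l x : << 0, x >> = 0.
Proof. exact: linear0r. Qed.
Lemma inner0r x : << x, 0 >> = 0.
Proof. exact: linear0l. Qed.
Lemma innerZl c x y : << c *: x, y >> = c^* * << x, y >>.
Proof. exact: linearZr_LR. Qed.
Lemma innerZr c x y : << x, c *: y >> = c * << x, y >>.
Proof. exact: linearZl_LR. Qed.
Lemma innerC x y : << x, y >>^* = << y, x >>.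
Proof. by rewrite /inner [in RHS]hermC /= expr0 mul1r. Qed.

Section Potential.
Variables (S : choiceType) (z : S -> D).

(** The second coordinate of a homomorphism from words to the Heisenberg group
    of [f] whose first coordinate is [word_sum z].  The condition on letters
    says that the lifts of [s] and of its formal inverse are mutually
    inverse. *)
Definition word_potential (P : word S -> C) : Prop :=
  (forall u v, P (u ++ v) = P u + P v - << word_sum z u, word_sum z v >>) /\
  (forall s, P [:: (s, false)] + P [:: (s, true)] = - << z s, z s >>).

(** The potential of the lift [s |-> (z s, - <z s, z s> / 2)].  A conjugation
    symmetric potential must have this real part on letters; a letter and its
    formal inverse get the same value. *)
Fixpoint hermitian_potential (w : word S) : C :=
  if w is l :: w' then
    - << z l.1, z l.1 >> / 2 + hermitian_potential w'
      - << word_sum z [:: l], word_sum z w' >>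
  else 0.

Lemma hermitian_potentialP : word_potential hermitian_potential.
Proof.
split=> [u v|s]; last first.
  rewrite /= !word_sum_nil !inner0r !addr0 !subr0.
  by rewrite -mulrDl -mulr2n -[_ *+ 2]mulr_natr mulfK ?pnatr_eq0.
elim: u => [|l u IHu].
  by rewrite word_sum_nil inner0l subr0 add0r.
rewrite /= IHu -(cat1s l u) !word_sum_cat innerDl innerDr; ring.
Qed.

(** Both sides reverse the order of the letters, and reversing the arguments of
    the inner product conjugates it, while the two signs coming from inverting
    the letters cancel. *)
Lemma hermitian_potential_inv w :
  hermitian_potential (inv_word w) = (hermitian_potential w)^*.
Proof.
have [PM _] := hermitian_potentialP.
elim: w => [|[s b] w IHw]; first by rewrite conjC0.
have -> : inv_word ((s, b) :: w) = inv_word w ++ inv_word [:: (s, b)].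
  by rewrite /inv_word /= rev_cons -cats1.
rewrite PM -(cat1s (s, b) w) PM IHw !word_sum_inv innerNl innerNr opprK.
have letterV : hermitian_potential (inv_word [:: (s, b)])
    = (hermitian_potential [:: (s, b)])^*.
  rewrite -[inv_word _]/[:: (s, ~~ b)] /= !word_sum_nil !inner0r !addr0 !subr0.
  by rewrite rmorphM rmorphN /= innerC fmorphV rmorph_nat.
rewrite letterV -innerC; move: (hermitian_potential [:: _]) => p.
by rewrite rmorphB rmorphD /= [p^* + _]addrC.
Qed.

Variable P : word S -> C.
Hypothesis PP : word_potential P.

Lemma potential_nil : P [::] = 0.
Proof.
have [PM _] := PP; apply: (addrI (P [::])).
by rewrite addr0 [RHS](PM [::] [::]) word_sum_nil inner0l subr0.
Qed.

Lemma potential_cancel s b : P [:: (s, b); (s, ~~ b)] = 0.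
Proof.
have [PM PV] := PP; rewrite -cat1s PM.
have -> : P [:: (s, b)] + P [:: (s, ~~ b)] = - << z s, z s >>.
  by case: b => //=; rewrite addrC.
rewrite !word_sum1; case: b => /=.
  by rewrite innerNl opprK addNr.
by rewrite innerNr opprK addNr.
Qed.

(** A factor with trivial image in the Heisenberg group can be deleted. *)
Lemma potential_delete r u v :
  word_sum z r = 0 -> P r = 0 -> P (u ++ r ++ v) = P (u ++ v).
Proof.
have [PM _] := PP => r0 Pr0.
by rewrite !PM word_sum_cat r0 Pr0 inner0l subr0 !add0r.
Qed.

End Potential.
End Inner.

(** * Evaluation on the surface relator *)

Section SurfaceRelator.
Variable k : nat.
Local Notation S := ('I_k + 'I_k)%type.

Definition handle (j : 'I_k) : word S :=
  [:: (inl j, false); (inr j, false); (inl j, true); (inr j, true)].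

Lemma word_sum_handle (V : zmodType) (z : S -> V) j : word_sum z (handle j) = 0.
Proof.
rewrite /word_sum /handle !big_cons big_nil /= addr0.
by rewrite -opprD addrA subrr.
Qed.

Lemma word_sum_handles (V : zmodType) (z : S -> V) r :
  word_sum z (flatten [seq handle j | j <- r]) = 0.
Proof.
elim: r => [|j r IHr]; first by rewrite word_sum_nil.
rewrite -[flatten _]/(handle j ++ flatten [seq handle i | i <- r]).
by rewrite word_sum_cat word_sum_handle IHr addr0.
Qed.

Lemma word_sum_relator (V : zmodType) (z : S -> V) :
  word_sum z (surface_relator k) = 0.
Proof. exact: word_sum_handles. Qed.

Section Potential.
Variables (C : numClosedFieldType) (D : lmodType C) (f : {dot D for Num.conj}).
Variables (z : S -> D) (P : word S -> C).
Hypothesis PP : word_potential f z P.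
Local Notation "<< x , y >>" := (inner f x y).

(** The commutator in the Heisenberg group: the contributions of the letters
    cancel against the terms [<x, x>] and [<y, y>], and only the antisymmetric
    part of the inner product is left. *)
Lemma potential_handle j :
  P (handle j) = << z (inr j), z (inl j) >> - << z (inl j), z (inr j) >>.
Proof.
have [PM PV] := PP.
rewrite /handle -cat1s -[[:: (inr j, false); _; _]]cat1s.
rewrite -[[:: (inl j, true); _]]cat1s !PM !word_sum_cat !word_sum1 /=.
have -> : P [:: (inl j, true)] = - << z (inl j), z (inl j) >> - P [:: (inl j, false)].
  by rewrite -PV addrAC subrr add0r.
have -> : P [:: (inr j, true)] = - << z (inr j), z (inr j) >> - P [:: (inr j, false)].
  by rewrite -PV addrAC subrr add0r.
rewrite !innerDr !innerNl !innerNr; ring.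
Qed.

(** The handles have image [0] in [D], so the Heisenberg group sees them as
    central elements and the values simply add up. *)
Lemma potential_relator :
  P (surface_relator k) =
    (\sum_j << z (inl j), z (inr j) >>)^* - \sum_j << z (inl j), z (inr j) >>.
Proof.
rewrite rmorph_sum -sumrB /surface_relator -[index_enum _]enumT.
rewrite -/(handle _) -[LHS]/(P (flatten [seq handle j | j <- enum 'I_k])).
elim: (enum 'I_k) => [|j r IHr]; first by rewrite big_nil (potential_nil PP).
have [PM _] := PP.
rewrite -[flatten _]/(handle j ++ flatten [seq handle i | i <- r]).
by rewrite big_cons PM word_sum_handle inner0l subr0 potential_handle IHr /= innerC.
Qed.

Lemma potential_relator_eq0 :
  (P (surface_relator k) == 0) = (\sum_j << z (inl j), z (inr j) >> \is Num.real).
Proof. by rewrite potential_relator subr_eq0 CrealE. Qed.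

End Potential.
End SurfaceRelator.

(** * Linear maps on a group algebra *)

(** Maps defined by a sum over the support cover linear extensions, the counit
    and the antilinear involution at once; hence a summand that is only
    assumed additive in the coefficient. *)
Section SuppSum.
Variables (R : nzRingType) (G : groupType) (V : zmodType) (F : G -> R -> V).
Local Notation A := (group_algebra R G).
Hypothesis FD : forall g x y, F g (x + y) = F g x + F g y.

Definition supp_sum (a : A) : V := \sum_(g <- msupp a) F g a@_g.

Let F0 g : F g 0 = 0.
Proof. by apply: (addrI (F g 0)); rewrite -FD !addr0. Qed.

Lemma supp_sumw (d : {fset G}) (a : A) :
  (msupp a `<=` d)%fset -> supp_sum a = \sum_(g <- d) F g a@_g.
Proof.
by move=> le_d; apply: big_fset_incl => // g _ /mcoeff_outdom ->.
Qed.

Lemma supp_sumD a b : supp_sum (a + b) = supp_sum a + supp_sum b.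
Proof.
rewrite (supp_sumw (msuppD_le a b)) (supp_sumw (fsubsetUl _ (msupp b))).
rewrite (supp_sumw (fsubsetUr (msupp a) _)) -big_split /=.
by apply: eq_bigr => g _; rewrite mcoeffD FD.
Qed.

Lemma supp_sumZ x a : supp_sum (x *: a) = \sum_(g <- msupp a) F g (x * a@_g).
Proof.
rewrite (supp_sumw (msuppZ_le x a)).
by apply: eq_bigr => g _; rewrite mcoeffZ.
Qed.

Lemma supp_sum_elt g : supp_sum (ga_elt g) = F g 1.
Proof. by rewrite /supp_sum msuppU oner_eq0 big_seq_fset1 mcoeffUU. Qed.

End SuppSum.

Section GroupAlgebraLinear.
Variables (C : numClosedFieldType) (G : groupType).
Local Notation A := (group_algebra C G).
Local Notation eps := (@ga_counit C G).

Lemma ga_span (P : A -> Prop) :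
  (forall a b, P a -> P b -> P (a + b)) -> (forall x a, P a -> P (x *: a)) ->
  (forall g, P (ga_elt g)) -> forall a, P a.
Proof.
move=> PD PZ Pg; elim/ga_ind => [|a b|x g]; last 2 first.
- exact: PD.
- by rewrite -[x]mulr1 -ga_scaleU; apply/PZ/Pg.
by rewrite -(scale0r (ga_elt 1%g)); exact: PZ.
Qed.

Lemma ga_counitD a b : eps (a + b) = eps a + eps b.
Proof. exact: (@supp_sumD C G C (fun=> id)). Qed.

Lemma ga_counitZ x a : eps (x *: a) = x * eps a.
Proof. by rewrite [LHS](@supp_sumZ C G C (fun=> id)) // -mulr_sumr. Qed.

Lemma ga_starD (a b : A) : ga_star (a + b) = ga_star a + ga_star b.
Proof.
apply: (@supp_sumD C G A (fun g x => << x^* *g g^-1%g >>)) => g x y.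
by rewrite rmorphD monalgUD.
Qed.

Lemma ga_starZ x (a : A) : ga_star (x *: a) = x^* *: ga_star a.
Proof.
rewrite [LHS](@supp_sumZ C G A (fun g x => << x^* *g g^-1%g >>)) => [|g y z].
  by rewrite scaler_sumr; apply: eq_bigr => g _; rewrite ga_scaleU rmorphM.
by rewrite rmorphD monalgUD.
Qed.

Section Linear.
Variables (V : lmodType C).

Definition ga_extend (phi : G -> V) : A -> V := supp_sum (fun g x => x *: phi g).

Lemma ga_extend_elt phi g : ga_extend phi (ga_elt g) = phi g.
Proof. by rewrite /ga_extend supp_sum_elt scale1r. Qed.

Lemma ga_extend_linear phi : linear (ga_extend phi).
Proof.
have FD g x y : (x + y) *: phi g = x *: phi g + y *: phi g by rewrite scalerDl.
move=> x a b; rewrite /ga_extend supp_sumD // supp_sumZ //; congr (_ + _).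
by rewrite scaler_sumr; apply: eq_bigr => g _; rewrite scalerA.
Qed.

Lemma linear_funD (F : A -> V) : linear F -> forall a b, F (a + b) = F a + F b.
Proof. by move=> F_lin a b; rewrite -[a in LHS]scale1r F_lin scale1r. Qed.

Lemma linear_funZ (F : A -> V) :
  linear F -> forall x a, F (x *: a) = x *: F a.
Proof.
move=> F_lin x a.
have F0 : F 0 = 0 by apply: (addrI (F 0)); rewrite -linear_funD // !addr0.
by rewrite -[_ *: a]addr0 F_lin F0 addr0.
Qed.

Lemma linear_eq_elt (F F' : A -> V) :
  linear F -> linear F' -> (forall g, F (ga_elt g) = F' (ga_elt g)) -> F =1 F'.
Proof.
move=> F_lin F'_lin FF'; apply: ga_span => // [a b Fa Fb|x a Fa].
  by rewrite !linear_funD // Fa Fb.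
by rewrite !linear_funZ // Fa.
Qed.

(** Both sides of the cocycle identity are bilinear in the two algebra
    elements, so it can be tested on pairs of group elements, where the counit
    is [1]. *)
Lemma gaussian_cocycle_morphism (F : A -> V) :
  linear F ->
  gaussian_cocycle F <->
  forall g h, F (ga_elt (g * h)%g) = F (ga_elt g) + F (ga_elt h).
Proof.
move=> F_lin; split=> [[_ FM] g h|FM].
  by rewrite ga_eltM FM !ga_counit_elt !scale1r addrC.
split=> //; elim/ga_span => [a a' IH IH' b|x a IH b|g].
- by rewrite mulrDl !linear_funD // IH IH' ga_counitD scalerDl scalerDr addrACA.
- rewrite -ga_scaleAl !linear_funZ // IH ga_counitZ scalerDr !scalerA.
  by rewrite [x * eps b]mulrC.
elim/ga_span => [b b' IH IH'|x b IH|h].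
- by rewrite mulrDr !linear_funD // IH IH' ga_counitD scalerDl scalerDr addrACA.
- rewrite -ga_scaleAr !linear_funZ // IH ga_counitZ scalerDr !scalerA.
  by rewrite [x * eps _]mulrC.
by rewrite -ga_eltM FM !ga_counit_elt !scale1r addrC.
Qed.

End Linear.

(** The defining identity of a generating functional is bilinear as well, because
    the antilinear argument of the inner product is composed with the
    antilinear involution.  On group elements [eta g^-1 = - eta g] absorbs the
    sign on the right hand side. *)
Lemma admits_generating_functional_morphism (D : lmodType C)
    (f : {dot D for Num.conj}) (eta : A -> D) :
  gaussian_cocycle eta ->
  admits_generating_functional f eta <->
  exists phi : G -> C,
    (forall g, phi g^-1%g = (phi g)^*) /\
    forall g h, phi (g * h)%g =
      phi g + phi h - inner f (eta (ga_elt g)) (eta (ga_elt h)).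
Proof.
move=> eta_gc; have [eta_lin _] := eta_gc.
have /(gaussian_cocycle_morphism eta_lin) etaM := eta_gc.
have eta1 : eta (ga_elt 1%g) = 0.
  by apply: (addrI (eta (ga_elt 1%g))); rewrite -etaM mulg1 addr0.
have etaV g : eta (ga_elt g^-1%g) = - eta (ga_elt g).
  by apply: (addrI (eta (ga_elt g))); rewrite -etaM mulgV eta1 subrr.
split=> [[psi [psi_lin psiS psiM]]|[phi [phiV phiM]]].
  exists (psi \o ga_elt); split=> [g|g h] /=; first by rewrite -psiS ga_star_elt.
  have := psiM (ga_elt g) (ga_elt h).
  rewrite !ga_counit_elt mul1r mulr1 ga_star_elt etaV innerNl opprK -ga_eltM => <-.
  by ring.
pose psi : A -> C := @ga_extend C^o phi.
have psi_lin : scalar psi := @ga_extend_linear C^o phi.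
have psiD := @linear_funD C^o psi psi_lin.
have psiZ : forall x a, psi (x *: a) = x * psi a := @linear_funZ C^o psi psi_lin.
have psiE g : psi (ga_elt g) = phi g := @ga_extend_elt C^o phi g.
exists psi; split=> // [|a b].
  elim/ga_span => [a b IH IH'|x a IH|g].
  - by rewrite ga_starD !psiD IH IH' rmorphD.
  - by rewrite ga_starZ !psiZ IH rmorphM.
  - by rewrite ga_star_elt !psiE phiV.
elim/ga_span: a b => [a a' IH IH' b|x a IH b|g].
- rewrite mulrDl ga_starD !psiD ga_counitD linear_funD // innerDl [in RHS]opprD -IH -IH'; ring.
- rewrite -ga_scaleAl ga_starZ !psiZ ga_counitZ linear_funZ // innerZl conjCK.
  rewrite -[in RHS]mulrN -IH; ring.
elim/ga_span => [b b' IH IH'|x b IH|h].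
- rewrite mulrDr !psiD ga_counitD linear_funD // innerDr [in RHS]opprD -IH -IH'; ring.
- rewrite -ga_scaleAr !psiZ ga_counitZ linear_funZ // innerZr.
  rewrite -[in RHS]mulrN -IH; ring.
rewrite -ga_eltM !psiE !ga_counit_elt ga_star_elt etaV innerNl phiM; ring.
Qed.

End GroupAlgebraLinear.

(** * Gaussian cocycles on the surface group *)

Section Surface.
Variables (C : numClosedFieldType) (k : nat).
Local Notation G := (surface_group k).
Local Notation A := (group_algebra C G).
Local Notation S := ('I_k + 'I_k)%type.
Local Notation wcl := (word_class [:: surface_relator k]).

Lemma surface_word_invariant (T : Type) (F : word S -> T) :
  (forall s b u v, F (u ++ [:: (s, b); (s, ~~ b)] ++ v) = F (u ++ v)) ->
  (forall u v, F (u ++ surface_relator k ++ v) = F (u ++ v)) ->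
  forall u v, wcl u = wcl v -> F u = F v.
Proof.
move=> Fcancel Frel; apply: word_invariant_eq => // r u v.
by rewrite inE => /eqP->.
Qed.

Lemma surface_cocycle_exists_unique (D : lmodType C) (x y : 'I_k -> D) :
  exists! eta : A -> D, gaussian_cocycle eta /\
    forall j, eta (ga_elt (surface_a j)) = x j /\ eta (ga_elt (surface_b j)) = y j.
Proof.
pose z (s : S) := match s with inl j => x j | inr j => y j end.
have zE : forall u v, wcl u = wcl v -> word_sum z u = word_sum z v.
  apply: surface_word_invariant => [s b u v|u v]; rewrite !word_sum_cat.
    by rewrite word_sum_cancel add0r.
  by rewrite word_sum_relator add0r.
pose phi (g : G) := word_sum z (repr g).
have phiE w : phi (wcl w) = word_sum z w by apply: zE; rewrite word_class_repr.
have phiM g h : phi (g * h)%g = phi g + phi h.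
  rewrite -[g]word_class_repr -[h]word_class_repr -word_class_cat !phiE.
  exact: word_sum_cat.
have phi_gen s : phi (pg_gen _ s) = z s by rewrite phiE word_sum1.
exists (ga_extend phi); split=> [|eta [eta_gc etaxy]].
  split=> [|j]; last by rewrite !ga_extend_elt !phi_gen.
  apply/gaussian_cocycle_morphism; first exact: ga_extend_linear.
  by move=> g h; rewrite !ga_extend_elt.
have [eta_lin _] := eta_gc.
apply/funext/linear_eq_elt => //; first exact: ga_extend_linear.
have /(gaussian_cocycle_morphism eta_lin) etaM := eta_gc.
have etaz s : eta (ga_elt (pg_gen _ s)) = z s.
  by case: s => j; case: (etaxy j).
move=> g; rewrite ga_extend_elt -[g]word_class_repr phiE.
by rewrite (word_sum_morphism etaM); apply: eq_bigr => l _; rewrite /= etaz.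
Qed.

Lemma surface_generating_functional (D : lmodType C) (f : {dot D for Num.conj})
    (eta : A -> D) :
  gaussian_cocycle eta ->
  admits_generating_functional f eta <->
  \sum_(j < k) inner f (eta (ga_elt (surface_a j)))
                       (eta (ga_elt (surface_b j))) \is Num.real.
Proof.
move=> eta_gc; have [eta_lin _] := eta_gc.
have /(gaussian_cocycle_morphism eta_lin) etaM := eta_gc.
have etaE w : eta (ga_elt (wcl w)) = _ := word_sum_morphism etaM w.
set z := _ \o _ in etaE.
rewrite -[X in X \is _]/(\sum_j inner f (z (inl j)) (z (inr j))).
split=> [/(admits_generating_functional_morphism _ eta_gc) [phi [_ phiM]]|].
  have phi1 : phi 1%g = 0.
    have := phiM 1%g 1%g; rewrite mulg1 (etaE [::]) word_sum_nil inner0l subr0.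
    by move=> e; apply: (addrI (phi 1%g)); rewrite addr0 -e.
  pose P w := phi (wcl w).
  (* Cancelling letters and the relator both map to 1, where phi vanishes. *)
  have PP : word_potential f z P.
    split=> [u v|s]; first by rewrite /P word_class_cat phiM !etaE.
    have := phiM (wcl [:: (s, false)]) (wcl [:: (s, true)]).
    rewrite {1}word_class_letterV mulgV phi1 !etaE !word_sum1 innerNr opprK.
    by move/esym/eqP; rewrite addr_eq0 => /eqP.
  rewrite -(potential_relator_eq0 PP) -phi1; apply/eqP; congr phi.
  apply/word_class_sound.
  by have := word_equiv_relator [::] [::] (mem_head (surface_relator k) [::]); rewrite cats0.
have PP := hermitian_potentialP f z; set P := hermitian_potential f z in PP.
rewrite -(potential_relator_eq0 PP) => /eqP P_rel.
have PE : forall u v, wcl u = wcl v -> P u = P v.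
  apply: surface_word_invariant => [s b u v|u v]; apply: (potential_delete PP) => //.
  - exact: word_sum_cancel.
  - exact: potential_cancel PP _ _.
  - exact: word_sum_relator.
apply/(admits_generating_functional_morphism _ eta_gc).
pose phi (g : G) := P (repr g).
have phiE w : phi (wcl w) = P w by apply: PE; rewrite word_class_repr.
exists phi; split=> [g|g h].
  rewrite -[g]word_class_repr -word_class_inv !phiE.
  exact: hermitian_potential_inv.
rewrite -[g]word_class_repr -[h]word_class_repr -word_class_cat !phiE !etaE.
by have [PM _] := PP; exact: PM.
Qed.

Lemma surface_not_property_GC : (0 < k)%N -> ~ property_GC C G.
Proof.
move=> k_gt0 GC; pose j0 : 'I_k := Ordinal k_gt0.
(* One nonzero x suffices to leave a single, purely imaginary, summand. *)
pose x (j : 'I_k) : 'rV[C]_1 := const_mx (j == j0)%:R.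
pose y (j : 'I_k) : 'rV[C]_1 := const_mx 'i.
have [eta [[eta_gc etaxy] _]] := surface_cocycle_exists_unique x y.
have := GC _ (@dotmx C 1) eta eta_gc.
move/(surface_generating_functional _ eta_gc).
have innerE j : inner (@dotmx C 1) (eta (ga_elt (surface_a j)))
    (eta (ga_elt (surface_b j))) = if j == j0 then 'i else 0.
  have [-> ->] := etaxy j; rewrite -[inner _ _ _]/(dotmx (y j) (x j)).
  rewrite dotmxE !mxE big_ord1 !mxE conjC_nat.
  by case: (j == j0); rewrite ?mulr1 ?mulr0.
rewrite (eq_bigr _ (fun j _ => innerE j)) -big_mkcond big_pred1_eq => /CrealP.
by rewrite conjCi => /eqP; rewrite eqNr (negPf (neq0Ci _)).
Qed.

End Surface.

Theorem proposition4p1 (R : realType) (k : nat) (k_ge2 : (2 <= k)%N) :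
  (forall (D : lmodType R[i]) (f : {dot D for Num.conj}),
    (forall x y : 'I_k -> D,
      exists! eta : group_algebra R[i] (surface_group k) -> D,
        gaussian_cocycle eta /\
        forall j : 'I_k, eta (ga_elt (surface_a j)) = x j /\
                         eta (ga_elt (surface_b j)) = y j) /\
    (forall eta : group_algebra R[i] (surface_group k) -> D,
      gaussian_cocycle eta ->
      (admits_generating_functional f eta <->
       \sum_(j < k) inner f (eta (ga_elt (surface_a j)))
                            (eta (ga_elt (surface_b j))) \is Num.real))) /\
  ~ property_GC R[i] (surface_group k).
Proof.
split; last exact: surface_not_property_GC (ltnW k_ge2).
move=> D f; split=> [x y|eta eta_gc].
- exact: surface_cocycle_exists_unique.
- exact: surface_generating_functional.
Qed.
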